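(* For every integer $d\ge 1$, \[ \alpha_5(d)= \begin{cases} 5,&d=2,\\ 16,&d=4,\\ \displaystyle\left\lceil\frac15\binom{d+4}{4}\right\rceil,&d\notin\{2,4\}. \end{cases} \]
   Context: For integers $q\ge 2$, $d\ge 0$, let $\Delta_q(d)=\{a\in\mathbb Z_{\ge0}^q:\sum_{i=1}^q a_i=d\}$, and let $e_1,\dots,e_q$ be the standard unit vectors of $\mathbb Z^q$. The graph $G_q(d)$ has vertex set $\Delta_q(d)$; distinct $a,b\in\Delta_q(d)$ are adjacent exactly when $a-b=e_i-e_j$ for some $i\ne j$. Write $\alpha_q(d)=\alpha(G_q(d))$ for its independence number (maximum size of an independent set). *)

(* Defs.v *)
From mathcomp Require Import all_boot all_order all_algebra.

Set Implicit Arguments.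
Unset Strict Implicit.
Unset Printing Implicit Defensive.

Import GRing.Theory.
Local Open Scope ring_scope.

Section IndependenceNumber.
Variables (T : finType) (V : {set T}) (e : rel T).

Definition independent (S : {set T}) : bool :=
  (S \subset V) && [forall a in S, forall b in S, ~~ e a b].

Definition independence_number : nat := (\max_(S : {set T} | independent S) #|S|)%N.

End IndependenceNumber.

(* The coordinates of a point of Delta_q(d) are at most d, so they are taken  *)
(* in 'I_d.+1; this makes the ambient type finite.                            *)
Definition point (q d : nat) : finType := {ffun 'I_q -> 'I_d.+1}.

Definition Delta (q d : nat) : {set point q d} :=
  [set a : point q d | (\sum_(i < q) a i)%N == d].

Definition zvec (q d : nat) (a : point q d) : 'rV[int]_q := \row_k (a k)%:Z.

Definition unit_vec (q : nat) (i : 'I_q) : 'rV[int]_q := delta_mx 0 i.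

Definition adj (q d : nat) : rel (point q d) := fun a b =>
  (a != b) &&
  [exists i : 'I_q, exists j : 'I_q,
     (i != j) && (zvec a - zvec b == unit_vec i - unit_vec j)].

Definition alpha (q d : nat) : nat := independence_number (Delta q d) (@adj q d).

(* Main.v *)
(* A cell {c + e_S : |S| = k}, where e_S is the sum of the e_i for i in S,
   meets an independent set in at most 1, 2, 2, 1 points for k = 1, 2, 3, 4.
   Covering a finite region by cells with rational weights therefore bounds the
   size of an independent set inside it, and after rounding down the bound is
   at most |R|/5 for the following regions R: the boxes 5 x 2 x 2 x 2 (fifth
   coordinate free) of odd degree, and three regions of even degree 12 and 14.
   Cutting along hyperplanes x_i = n, translates of these tile the slab x_1 < 5
   of Delta_5(d) for odd d, and the slab x_1 < 10 for even d >= 12. Removing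
   slabs leaves a translate of Delta_5(d - 5) or Delta_5(d - 10), so only a few
   degrees remain, and these are settled by weighted coverings too. In degree 6
   coverings only give 43: after removal of the five corner cliques one
   branches on whether some permutation of (3,1,1,1,0) belongs to the set. The
   lower bound is the pigeonhole principle for the proper colouring sum_i i a_i
   mod 5; the even points do better in degree 2 and, together with (1,1,1,1,0),
   in degree 4. *)
Require Import Defs.
From Stdlib Require Import ZArith.
From mathcomp Require Import all_boot all_order all_algebra.
From mathcomp Require Import zify lra.

Set Implicit Arguments.
Unset Strict Implicit.
Unset Printing Implicit Defensive.

(** * Independent sets as predicates on coordinate lists *)

(** Adjacency is written without subtraction, as [l + e_i = l' + e_j], and no degree is fixed. A
    predicate, unlike a finite set of points, is translated by mere precomposition. *)
Definition indep (f : pred (seq nat)) : Prop :=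
  forall l l' i j, size l = 5 -> size l' = 5 -> i < 5 -> j < 5 -> i != j ->
    incr_nth l i = incr_nth l' j -> f l -> f l' -> False.

Definition translate n i (l : seq nat) : seq nat := iter n (incr_nth^~ i) l.

Lemma translate_cons n i a l : translate n i.+1 (a :: l) = a :: translate n i l.
Proof. by rewrite /translate; elim: n => //= n ->. Qed.

Lemma size_incr_nth5 (l : seq nat) i : size l = 5 -> i < 5 -> size (incr_nth l i) = 5.
Proof. by move=> sz_l lt_i; rewrite size_incr_nth sz_l lt_i. Qed.

Lemma indep_translate n i (f : pred (seq nat)) :
  i < 5 -> indep f -> indep (fun l => f (translate n i l)).
Proof.
move=> lt_i; elim: n f => [//|n IHn] f ind_f.
rewrite /translate /=.
apply: (IHn (fun l => f (incr_nth l i))).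
move=> l l' j k sz_l sz_l' lt_j lt_k neq_jk eq_ll'.
apply: (ind_f _ _ j k) => //; try exact: size_incr_nth5.
by rewrite incr_nthC eq_ll' incr_nthC.
Qed.

(** * Slices of the simplex and their cuts along hyperplanes *)

(* The bound None stands for an unbounded coordinate. *)
Definition width (n : option nat) (r : nat) : nat :=
  if n is Some k then minn k r.+1 else r.+1.

(* The fifth coordinate is never bounded: it absorbs the remaining degree. *)
Fixpoint slice (ns : seq (option nat)) (r : nat) : seq (seq nat) :=
  if ns is n :: ns' then
    [seq a :: l | a <- iota 0 (width n r), l <- slice ns' (r - a)]
  else [:: [:: r]].

Lemma count_slice_cons f n ns r :
  count f (slice (n :: ns) r) =
    \sum_(0 <= a < width n r) count (fun l => f (a :: l)) (slice ns (r - a)).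
Proof.
rewrite /= count_flatten sumnE !big_map /index_iota subn0.
by apply: eq_bigr => a _; rewrite count_map.
Qed.

Definition drop_side n (s : option nat) : option nat :=
  if s is Some k then Some (k - n) else None.

(** In degree [r < n] no coordinate reaches [n], so bounds [n] and above cut nothing off. *)
Lemma slice_cap pre n post s r : r < n -> (if s is Some k then n <= k else true) ->
  slice (pre ++ s :: post) r = slice (pre ++ Some n :: post) r.
Proof.
move=> lt_rn le_ns; elim: pre r lt_rn => [|m pre IHpre] r lt_rn /=.
  have -> // : width s r = minn n r.+1.
  by case: s le_ns => [k|] /=; lia.
congr flatten; apply/eq_map => a /=.
by rewrite IHpre //; lia.
Qed.

Lemma count_slice_split f pre n post s r : n <= r ->
    (if s is Some k then n <= k else true) ->
  count f (slice (pre ++ s :: post) r) =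
    count f (slice (pre ++ Some n :: post) r)
    + count (fun l => f (translate n (size pre) l))
            (slice (pre ++ drop_side n s :: post) (r - n)).
Proof.
move=> le_nr le_ns; elim: pre f r le_nr => [|m pre IHpre] f r le_nr.
  rewrite !cat0s !count_slice_cons.
  have -> : width (Some n) r = n by rewrite /=; lia.
  have le_nw : n <= width s r by case: s le_ns => [k|] /=; lia.
  rewrite (big_cat_nat (leq0n n) le_nw) /=; congr addn.
  rewrite -{1}[n]add0n big_addn.
  have -> : width s r - n = width (drop_side n s) (r - n).
    by case: s le_ns le_nw => [k|] /=; lia.
  apply: eq_bigr => a _; rewrite addnC subnDA; apply: eq_count => l.
  by congr f; rewrite /translate; elim: (n) => //= k <-.
rewrite !cat_cons !count_slice_cons.
(* Beyond the hyperplane the first coordinate is at most [r - n]; [g] extends the count by 0 so that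
   both parts are summed over the same range. For larger [a] fewer than [n] units remain, and the
   hyperplane is not reached. *)
pose g a := if a <= r - n then
  count (fun l => f (translate n (size (m :: pre)) (a :: l)))
    (slice (pre ++ drop_side n s :: post) (r - n - a)) else 0.
transitivity (\sum_(0 <= a < width m r)
    (count (fun l => f (a :: l)) (slice (pre ++ Some n :: post) (r - a)) + g a)).
  apply: eq_big_nat => a /andP [_ lt_aw]; rewrite /g; case: leqP => [le_a | lt_a].
    rewrite (IHpre (fun l => f (a :: l))); last by lia.
    rewrite subnAC; congr addn; apply: eq_count => l /=.
    by rewrite translate_cons.
  rewrite addn0 (@slice_cap pre n) //.
  by case: m {g} lt_aw => [k|] /=; lia.
rewrite big_split /=; congr addn.
have le_w : width m (r - n) <= width m r by case: m {g} => [k|] /=; lia.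
rewrite (big_nat_widen _ _ _ _ _ le_w) [RHS]big_mkcond /=.
apply: eq_big_nat => a /andP [_ lt_a].
have -> : (a < width m (r - n)) = (a <= r - n).
  by case: m lt_a {g le_w} => [k|] /=; lia.
by rewrite /g.
Qed.

(* Once r is large the bounded coordinates no longer feel the degree, and the
   slice just moves in the direction of the free coordinate. *)
Lemma count_slice_full f ks r : sumn (map predn ks) <= r ->
  count f (slice (map Some ks) r.+1) =
    count (fun l => f (incr_nth l (size ks))) (slice (map Some ks) r).
Proof.
elim: ks f r => [|k ks IHks] f r; first by [].
move=> le_r; rewrite [map Some _]/= !count_slice_cons.
have le_kr : k.-1 + sumn (map predn ks) <= r by [].
have -> : width (Some k) r.+1 = width (Some k) r by rewrite /=; lia.
apply: eq_big_nat => a /andP [_ lt_a]; rewrite /= in lt_a.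
rewrite subSn; last by lia.
by rewrite (IHks (fun l => f (a :: l))) //; lia.
Qed.

(** * Regions of density at most one fifth, and their gluing *)

(** With [e = 0] no loss accumulates when regions are glued; [e = 4] is exactly what rounding up a
    fifth of the size permits. *)
Definition near_tight (ns : seq (option nat)) (r e : nat) : Prop :=
  forall f, indep f -> 5 * count f (slice ns r) <= size (slice ns r) + e.

(** Counts and sizes both add over the cut, so the errors add, here to [0 + e]. *)
Lemma near_tight_split pre n post s r e : size pre < 5 ->
    (if s is Some k then n <= k else true) ->
    near_tight (pre ++ Some n :: post) r 0 ->
    (n <= r -> near_tight (pre ++ drop_side n s :: post) (r - n) e) ->
  near_tight (pre ++ s :: post) r e.
Proof.
move=> lt_pre le_ns tight1 tight2 f ind_f.
case: (leqP n r) => [le_nr | lt_rn]; last first.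
  by rewrite (@slice_cap pre n) //; have := tight1 f ind_f; lia.
have := tight2 le_nr _ (@indep_translate n _ _ lt_pre ind_f).
have := tight1 f ind_f.
have split g := @count_slice_split g pre _ post _ _ le_nr le_ns.
(* The cut applied to [predT] splits the size; the ascription identifies the translated [predT] with
   [predT] itself. *)
have := split predT : _ = _ + count predT _; rewrite !count_predT split; lia.
Qed.

(** Once the degree reaches the largest sum of the bounded coordinates, all further slices are
    translates of one another, so one degree settles all higher ones. *)
Lemma near_tight_full ks r r' e : size ks < 5 -> sumn (map predn ks) <= r -> r <= r' ->
  near_tight (map Some ks) r e -> near_tight (map Some ks) r' e.
Proof.
move=> lt_ks le_r le_rr' tight_r; elim: r' le_rr' => [|r' IHr'] le_rr'.
  by have <- : r = 0 by lia.
case: (eqVneq r r'.+1) => [<- // | neq_r] f ind_f.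
have le_r' : r <= r' by lia.
have full g := @count_slice_full g ks r' (leq_trans le_r le_r').
have := IHr' le_r' _ (@indep_translate 1 _ _ lt_ks ind_f).
by have := full predT : _ = count predT _; rewrite !count_predT full => ->.
Qed.

(* Integer weights on points, stored in tries *)
(* MathComp rebinds the key %Z to its own integers. *)
Delimit Scope Z_scope with ZZ.

(* Finitely supported integer weights on points: [here] collects the points
   with first coordinate 0, and [more] those with a positive first coordinate,
   which is lowered by 1. *)
Inductive trie := Leaf | Node (v : Z) (here : trie) (more : trie).

Fixpoint add_at (l : seq nat) (w : Z) (t : trie) {struct l} : trie :=
  match l with
  | [::] => match t with
            | Leaf => Node w Leaf Leaf
            | Node v h m => Node (v + w) h m
            end
  | n :: l' =>
      (fix go (n : nat) (t : trie) {struct n} : trie :=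
         match n, t with
         | 0, Leaf => Node 0 (add_at l' w Leaf) Leaf
         | 0, Node v h m => Node v (add_at l' w h) m
         | n'.+1, Leaf => Node 0 Leaf (go n' Leaf)
         | n'.+1, Node v h m => Node v h (go n' m)
         end) n t
  end.

(** The total weight of the points satisfying [f]. It serves in proofs only: [f] stays abstract, and
    computation touches the trie alone. *)
Fixpoint weigh (f : pred (seq nat)) (t : trie) : Z :=
  match t with
  | Leaf => 0
  | Node v h m =>
      v * Z.b2z (f [::]) + weigh (fun l => f (0%N :: l)) h
      + weigh (fun l => f (incr_nth l 0%N)) m
  end%ZZ.

Fixpoint trie_nonneg (t : trie) : bool :=
  if t is Node v h m then (0 <=? v)%ZZ && trie_nonneg h && trie_nonneg m else true.

Lemma weigh_nonneg f t : trie_nonneg t -> (0 <= weigh f t)%ZZ.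
Proof.
elim: t f => [|v h IHh m IHm] f //= /andP [/andP [/Z.leb_le v_ge0 /IHh h_ge0] /IHm m_ge0].
have := h_ge0 (fun l => f (0 :: l)); have := m_ge0 (fun l => f (incr_nth l 0)).
by case: (f _) => /=; lia.
Qed.

Lemma weigh_add_at f l w t : weigh f (add_at l w t) = (w * Z.b2z (f l) + weigh f t)%ZZ.
Proof.
elim: l f t => [|n l IHl] f t; first by case: t => [|v h m] /=; lia.
rewrite [add_at _ _ _]/=; elim: n f t => [|n IHn] f [|v h m] /=; rewrite ?IHl ?IHn /=; lia.
Qed.

Definition add_all (w : Z) (s : seq (seq nat)) (t : trie) : trie :=
  foldr (fun l => add_at l w) t s.

Lemma weigh_add_all f w s t :
  weigh f (add_all w s t) = (w * Z.of_nat (count f s) + weigh f t)%ZZ.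
Proof.
elim: s => [|l s IHs] /=; first by lia.
by rewrite weigh_add_at IHs; case: (f l) => /=; lia.
Qed.

(** * Cells and their independence numbers *)

(** At a zero coordinate the truncated predecessor changes nothing; the filter in [cell] discards
    such [i]. *)
Definition decr_nth (u : seq nat) i : seq nat := set_nth 0 u i (nth 0 u i).-1.

(* For k = 4 the cell is given by its upper corner c + (1,1,1,1,1), which keeps
   the coordinates natural when the cell leaves the positive orthant. *)
Definition cell (k : nat) (c : seq nat) : seq (seq nat) :=
  match k with
  | 1 => [seq incr_nth c i | i <- iota 0 5]
  | 2 => [seq incr_nth (incr_nth c i) j | i <- iota 0 5, j <- iota i.+1 (4 - i)]
  | 3 => [seq incr_nth (incr_nth (incr_nth c p.1) p.2) k
         | p <- [seq (i, j) | i <- iota 0 5, j <- iota i.+1 (4 - i)],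
           k <- iota p.2.+1 (4 - p.2)]
  | _ => [seq decr_nth c i | i <- iota 0 5 & incr_nth (decr_nth c i) i == c]
  end.

Definition cell_alpha (k : nat) : nat := if (k == 2) || (k == 3) then 2 else 1.

Lemma count_le1 (p : pred nat) s : uniq s ->
  {in s &, forall i j, i != j -> p i -> p j -> False} -> count p s <= 1.
Proof.
elim: s => [//|i s IHs] /= /andP [i_notin uniq_s] excl.
have le1 : count p s <= 1.
  by apply: IHs => // j k j_s k_s; apply: excl; rewrite inE ?j_s ?k_s orbT.
case: (boolP (p i)) => // p_i; rewrite add1n ltnS leqn0.
rewrite -leqn0 leqNgt -has_count; apply/hasP => -[j j_s p_j].
apply: (excl i j) => //; rewrite ?inE ?eqxx ?j_s ?orbT //.
by apply: contraNneq i_notin => ->.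
Qed.

Section Cell.
Variables (f : pred (seq nat)) (ind_f : indep f).

Lemma indep_up c i j : size c = 5 -> i < 5 -> j < 5 -> i != j ->
  f (incr_nth c i) -> f (incr_nth c j) -> False.
Proof.
move=> sz_c lt_i lt_j neq_ij f_i f_j; apply: (@ind_f (incr_nth c i) (incr_nth c j) j i) => //.
- exact: size_incr_nth5.
- exact: size_incr_nth5.
- by rewrite eq_sym.
by rewrite incr_nthC.
Qed.

Lemma count_star c : size c = 5 -> count f [seq incr_nth c i | i <- iota 0 5] <= 1.
Proof.
move=> sz_c; rewrite count_map; apply: count_le1; first exact: iota_uniq.
by move=> i j; rewrite !mem_iota => lt_i lt_j; apply: indep_up.
Qed.

Lemma count_costar c : size c = 5 -> count f (cell 4 c) <= 1.
Proof.
move=> sz_c; rewrite /cell count_map; apply: count_le1; first by rewrite filter_uniq ?iota_uniq.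
move=> i j; rewrite !mem_filter !mem_iota => /andP [/eqP eq_i lt_i] /andP [/eqP eq_j lt_j] neq_ij f_i f_j.
apply: (@ind_f (decr_nth c i) (decr_nth c j) i j); rewrite ?eq_i ?eq_j //.
  by rewrite /decr_nth size_set_nth sz_c; apply/maxn_idPr.
by rewrite /decr_nth size_set_nth sz_c; apply/maxn_idPr.
Qed.

(** The cell is the line graph of K_5, whose independent sets are matchings. Each pair lies in two
    of the five stars, so twice the count is at most 5. *)
Lemma count_cell2 c : size c = 5 -> count f (cell 2 c) <= 2.
Proof.
move=> sz_c; pose x i j : nat := f (incr_nth (incr_nth c i) j).
have xC i j : x i j = x j i by rewrite /x incr_nthC.
have star i : i < 5 -> x i 0 + x i 1 + x i 2 + x i 3 + x i 4 <= 1.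
  move=> lt_i; have := count_star (size_incr_nth5 sz_c lt_i).
  by rewrite /= -/(x i 0) -/(x i 1) -/(x i 2) -/(x i 3) -/(x i 4); lia.
have := star 0 isT; have := star 1 isT; have := star 2 isT; have := star 3 isT.
have := star 4 isT.
rewrite (xC 1 0) (xC 2 0) (xC 2 1) (xC 3 0) (xC 3 1) (xC 3 2) (xC 4 0) (xC 4 1) (xC 4 2) (xC 4 3).
rewrite /= -!/(x _ _); clearbody x; clear; lia.
Qed.

(** Triples inside one 4-subset are pairwise adjacent, and each triple lies in two of the five
    4-subsets, so twice the count is at most 5. *)
Lemma count_cell3 c : size c = 5 -> count f (cell 3 c) <= 2.
Proof.
move=> sz_c; pose x i j k : nat := f (incr_nth (incr_nth (incr_nth c i) j) k).
have xCA i j k : x i j k = x j i k by rewrite /x (incr_nthC c).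
have xAC i j k : x i j k = x i k j by rewrite /x (incr_nthC (incr_nth c i)).
have excl i j k l : i < 5 -> j < 5 -> k < 5 -> l < 5 -> k != l -> x i j k + x i j l <= 1.
  move=> lt_i lt_j lt_k lt_l neq_kl; rewrite leqNgt; apply/negP => gt1.
  move: gt1; rewrite /x; case x_k: (f _); case x_l: (f _) => // _.
  by apply: (@indep_up (incr_nth (incr_nth c i) j) k l) => //; rewrite !size_incr_nth5.
have costar i j k l : i < 5 -> j < 5 -> k < 5 -> l < 5 ->
    uniq [:: i; j; k; l] -> x i j k + x i j l + x i k l + x j k l <= 1.
  rewrite /= !inE !negb_or => lt_i lt_j lt_k lt_l /and4P [/and3P [ij ik il] /andP [jk jl] kl _].
  have := excl i j k l lt_i lt_j lt_k lt_l kl.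
  have := excl i k j l lt_i lt_k lt_j lt_l jl; have := excl j k i l lt_j lt_k lt_i lt_l il.
  have := excl i l j k lt_i lt_l lt_j lt_k jk; have := excl j l i k lt_j lt_l lt_i lt_k ik.
  have := excl k l i j lt_k lt_l lt_i lt_j ij.
  rewrite (xAC i k j) (xAC j k i) (xCA j i k) (xAC i l j) (xAC i l k) (xAC j l i) (xCA j i l).
  rewrite (xAC j l k) (xAC k l i) (xCA k i l) (xAC k l j) (xCA k j l).
  clearbody x; clear; lia.
have := costar 0 1 2 3 isT isT isT isT isT; have := costar 0 1 2 4 isT isT isT isT isT.
have := costar 0 1 3 4 isT isT isT isT isT; have := costar 0 2 3 4 isT isT isT isT isT.
have := costar 1 2 3 4 isT isT isT isT isT.
rewrite /= -!/(x _ _ _); clearbody x; clear; lia.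
Qed.

Lemma count_cell k c : size c = 5 -> count f (cell k c) <= cell_alpha k.
Proof.
move=> sz_c; case: k => [|[|[|[|k]]]].
- exact: count_costar.
- exact: count_star.
- exact: count_cell2.
- exact: count_cell3.
- exact: count_costar.
Qed.
End Cell.

(** * Covering certificates and their soundness *)

(* An entry (w, k, c) puts the weight w on each image of the cell (k, c) under
   a group of coordinate permutations, counted with multiplicity. *)
Definition certificate := seq (nat * nat * seq nat).

Definition perm_coords (T : Type) (x0 : T) (l : seq T) (g : seq nat) : seq T :=
  [seq nth x0 l i | i <- g].

Definition symmetries (l : seq nat) : seq (seq nat) :=
  [seq g <- permutations (iota 0 5) | perm_coords 0 l g == l].

Definition cover (G : seq (seq nat)) (cert : certificate) (t : trie) : trie :=
  foldr (fun x t => foldr (fun g =>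
    add_all (Z.of_nat x.1.1) (cell x.1.2 (perm_coords 0 x.2 g))) t G) t cert.

Definition cost (cert : certificate) : Z :=
  foldr (fun x s => Z.of_nat x.1.1 * Z.of_nat (cell_alpha x.1.2) + s)%ZZ 0%ZZ cert.

(* Each point of P gets total weight at least M |G|, and the total of the
   weights times the cell bounds is less than M |G| (B + 1). *)
Definition check (P : seq (seq nat)) (G : seq (seq nat)) (M : nat) (cert : certificate)
    (B : nat) : bool :=
  [&& all (fun g => size g == 5) G, 0 < size G,
      (cost cert <? Z.of_nat M * Z.of_nat B.+1)%ZZ
    & trie_nonneg (cover G cert (add_all (- (Z.of_nat M * Z.of_nat (size G))) P Leaf))].

Lemma weigh_cover f G cert t : indep f -> all (fun g => size g == 5) G ->
  (weigh f (cover G cert t) <= Z.of_nat (size G) * cost cert + weigh f t)%ZZ.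
Proof.
move=> ind_f all5; elim: cert => [|[[w k] c] cert IHcert]; first by rewrite /=; lia.
have step t' : (weigh f (foldr (fun g => add_all (Z.of_nat w) (cell k (perm_coords 0%N c g))) t' G)
        <= Z.of_nat (size G) * (Z.of_nat w * Z.of_nat (cell_alpha k)) + weigh f t')%ZZ; last first.
  have := step (cover G cert t).
  rewrite -[cost (_ :: _)]/(Z.of_nat w * Z.of_nat (cell_alpha k) + cost cert)%ZZ.
  rewrite -[foldr _ _ G]/(cover G ((w, k, c) :: cert) t).
  by lia.
clear IHcert; elim: G all5 => [|g G IHG]; first by rewrite [foldr _ _ _]/= [size _]/=; lia.
move=> /andP [/eqP sz_g /IHG le_G].
rewrite [foldr _ _ _]/= [size _]/= Nat2Z.inj_succ Z.mul_succ_l weigh_add_all.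
have := @count_cell f ind_f k (perm_coords 0 c g); rewrite size_map => /(_ sz_g) le_k.
have : (Z.of_nat w * Z.of_nat (count f (cell k (perm_coords 0%N c g)))
        <= Z.of_nat w * Z.of_nat (cell_alpha k))%ZZ.
  by apply: Z.mul_le_mono_nonneg_l; lia.
by lia.
Qed.

(** Nonnegativity of the final trie gives [0 <= |G| * cost - M * |G| * count]. Hence
    [M * count <= cost < M * (B + 1)], and integrality rounds the bound down to [B]. *)
Lemma check_sound P G M cert B f : check P G M cert B -> indep f -> count f P <= B.
Proof.
case/and4P => all5 G_gt0 /Z.ltb_lt lt_cost nonneg ind_f.
have := @weigh_cover f G cert (add_all (- (Z.of_nat M * Z.of_nat (size G))) P Leaf) ind_f all5.
have := @weigh_nonneg f _ nonneg; rewrite weigh_add_all [weigh f Leaf]/=.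
move: (cost cert) lt_cost (count f P) (size G) G_gt0 => c lt_c n g g_gt0 ge0 le_c.
have le1 : (Z.of_nat g * (Z.of_nat M * Z.of_nat n) <= Z.of_nat g * c)%ZZ by lia.
have le2 : (Z.of_nat M * Z.of_nat n <= c)%ZZ by apply/(Z.mul_le_mono_pos_l _ _ (Z.of_nat g)); lia.
by nia.
Qed.

(** Coordinates of equal width may be exchanged. Widths are capped by the degree, so a bound that
    cannot be felt counts as free; the last entry is the fifth coordinate. *)
Definition slice_symmetries ns r : seq (seq nat) :=
  symmetries (rcons [seq width n r | n <- ns] r.+1).

Lemma near_tight_check ns r e M cert B :
    check (slice ns r) (slice_symmetries ns r) M cert B ->
    5 * B <= size (slice ns r) + e ->
  near_tight ns r e.
Proof.
move=> chk le_B f ind_f; apply: leq_trans le_B.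
by rewrite leq_mul2l (check_sound chk).
Qed.

(** * Certificate data *)

(* Rounded solutions of the linear programs for the optimal weighted coverings. *)
Definition cert_5222_1 : certificate := [::
  (1,1,[::0;0;0;0;0])].

Definition cert_5222_3 : certificate := [::
  (2,1,[::0;0;0;0;2]); (1,3,[::0;0;0;0;0])].

Definition cert_5222_5 : certificate := [::
  (1,3,[::0;0;0;0;2]); (1,1,[::0;0;0;0;4]); (1,4,[::2;1;1;1;1]); (1,1,[::2;0;0;0;2]);
  (1,2,[::3;0;0;0;0])].

Definition cert_5222_7 : certificate := [::
  (1,3,[::0;0;0;0;4]); (1,1,[::0;0;0;0;6]); (1,4,[::2;1;1;1;3]); (1,1,[::2;0;0;0;4]);
  (1,2,[::3;0;0;0;2]); (1,4,[::4;1;1;1;1])].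

Definition cert_prism : certificate := [::
  (4,1,[::0;0;0;0;13]); (1,1,[::3;1;1;4;4]); (2,3,[::0;0;0;2;9]); (4,1,[::0;0;0;2;11]);
  (2,1,[::0;0;0;4;9]); (2,4,[::3;1;1;2;8]); (2,1,[::0;0;0;6;7]); (4,1,[::2;0;0;0;11]);
  (2,4,[::1;1;1;4;8]); (2,1,[::2;0;0;5;6]); (2,1,[::6;0;0;0;7]); (2,4,[::3;1;1;0;10]);
  (2,1,[::5;0;0;0;8]); (2,4,[::2;1;1;5;6]); (2,4,[::1;1;1;2;10]); (2,1,[::0;0;0;5;8]);
  (2,2,[::3;0;0;0;9]); (1,4,[::5;1;1;4;4]); (2,2,[::0;0;0;3;9]); (2,4,[::4;1;1;1;8]);
  (2,1,[::2;0;0;2;9]); (2,4,[::2;1;1;3;8]); (1,4,[::7;1;1;3;3]); (1,4,[::9;1;1;2;2]);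
  (2,3,[::6;0;0;0;5]); (2,3,[::4;0;0;0;7]); (2,4,[::5;1;1;2;6]); (2,1,[::2;0;0;4;7]);
  (2,1,[::2;0;0;3;8]); (2,2,[::2;0;0;1;9]); (2,2,[::3;0;0;2;7]); (2,1,[::4;0;0;0;9]);
  (2,4,[::2;1;1;1;10]); (1,2,[::6;0;0;3;3]); (2,1,[::4;0;0;2;7]); (4,3,[::0;0;0;0;11]);
  (2,2,[::4;0;0;3;5]); (2,2,[::8;0;0;0;4]); (2,4,[::4;1;1;3;6]); (2,1,[::6;0;0;2;5]);
  (2,3,[::0;0;0;4;7]); (2,1,[::7;0;0;0;6]); (2,3,[::5;0;0;0;6]); (2,3,[::5;0;0;2;4]);
  (2,1,[::8;0;0;0;5]); (2,4,[::7;1;1;1;5]); (2,3,[::0;0;0;5;6]); (2,2,[::3;0;0;4;5]);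
  (2,4,[::7;1;1;2;4]); (1,2,[::8;0;0;2;2]); (2,1,[::7;0;0;2;4]); (2,3,[::8;0;0;0;3]);
  (2,1,[::8;0;0;2;3]); (2,1,[::5;0;0;2;6]); (1,1,[::5;0;0;4;4]); (2,3,[::2;0;0;3;6]);
  (2,4,[::9;1;1;1;3])].

Definition cert_slab2 : certificate := [::
  (1427,3,[::0;0;0;0;11]); (370,4,[::4;1;1;1;8]); (444,1,[::4;0;2;3;4]); (1279,1,[::2;0;0;5;6]);
  (19,4,[::6;0;1;4;4]); (10,1,[::4;0;0;1;8]); (1428,1,[::0;0;0;0;13]); (1787,1,[::4;0;0;2;7]);
  (131,3,[::3;0;0;2;6]); (234,3,[::5;0;2;2;2]); (645,3,[::0;0;2;4;5]); (39,4,[::4;1;0;4;6]);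
  (1368,1,[::0;0;2;2;9]); (1724,1,[::0;0;2;4;7]); (23,2,[::7;0;0;0;5]); (2736,1,[::2;0;0;2;9]);
  (834,4,[::3;1;1;4;6]); (225,1,[::0;0;3;4;6]); (39,3,[::3;0;1;3;4]); (1542,1,[::2;0;0;4;7]);
  (84,3,[::0;0;2;3;6]); (17,1,[::9;1;0;0;3]); (47,1,[::1;0;2;2;8]); (2,3,[::1;0;0;0;10]);
  (245,1,[::3;0;2;2;6]); (57,1,[::2;0;1;4;6]); (1076,2,[::0;0;0;3;9]); (38,1,[::0;1;4;4;4]);
  (421,4,[::9;1;1;2;2]); (117,1,[::7;1;0;2;3]); (48,4,[::6;1;0;4;4]); (38,1,[::0;1;2;3;7]);
  (29,1,[::9;0;0;0;4]); (38,2,[::1;0;2;2;7]); (1428,1,[::0;0;0;6;7]); (61,3,[::1;0;0;1;9]);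
  (722,4,[::1;1;2;3;8]); (1114,1,[::2;0;2;4;5]); (8,4,[::8;1;2;2;2]); (534,4,[::5;1;1;4;4]);
  (57,4,[::2;1;0;4;8]); (96,2,[::4;0;2;2;4]); (46,4,[::6;1;0;2;6]); (80,4,[::4;1;0;2;8]);
  (294,1,[::6;0;2;2;3]); (57,3,[::0;0;1;3;7]); (112,2,[::5;0;0;3;4]); (182,1,[::3;0;0;4;6]);
  (939,3,[::6;0;0;0;5]); (31,3,[::0;0;1;1;9]); (203,4,[::1;1;1;6;6]); (13,4,[::3;1;2;2;7]);
  (1427,1,[::2;0;0;0;11]); (209,4,[::2;1;4;4;4]); (117,3,[::5;0;0;3;3]); (12,2,[::7;0;0;1;4]);
  (1051,3,[::5;0;0;2;4]); (261,1,[::7;0;2;2;2]); (136,1,[::2;0;3;3;5]); (34,2,[::8;0;0;1;3]);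
  (444,4,[::7;1;1;1;5]); (371,2,[::5;0;0;2;5]); (2856,1,[::0;0;0;2;11]); (483,3,[::0;0;2;2;7]);
  (1241,4,[::1;1;1;4;8]); (547,1,[::4;0;2;2;5]); (61,4,[::2;1;0;2;10]); (963,3,[::4;0;0;0;7]);
  (121,1,[::2;0;0;3;8]); (21,3,[::4;0;2;2;3]); (299,3,[::3;0;0;3;5]); (466,2,[::8;0;0;2;2]);
  (46,1,[::4;0;1;2;6]); (7,1,[::3;1;0;1;8]); (81,1,[::9;0;0;2;2]); (29,3,[::6;0;1;1;3]);
  (566,4,[::2;1;2;4;6]); (405,1,[::0;0;4;4;5]); (439,2,[::3;0;0;0;9]); (131,3,[::1;0;0;3;7]);
  (31,1,[::3;0;2;3;5]); (946,4,[::5;1;1;2;6]); (5,1,[::4;1;0;0;8]); (94,1,[::2;0;3;4;4]);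
  (381,4,[::2;1;1;1;10]); (444,1,[::5;0;0;0;8]); (66,4,[::5;1;1;3;5]); (185,4,[::4;1;2;2;6]);
  (154,4,[::3;1;3;4;4]); (498,2,[::2;0;2;3;5]); (152,3,[::0;0;3;3;5]); (1428,3,[::0;0;0;4;7]);
  (869,4,[::1;1;3;4;6]); (146,2,[::0;0;2;5;5]); (141,4,[::2;1;2;2;8]); (103,3,[::1;0;0;5;5]);
  (10,3,[::2;0;1;1;7]); (54,2,[::4;0;0;4;4]); (56,3,[::0;0;3;4;4]); (985,1,[::4;0;0;0;9]);
  (12,1,[::1;0;4;4;4]); (776,2,[::3;0;0;2;7]); (57,1,[::2;0;1;2;8]); (1133,1,[::0;0;2;5;6]);
  (4,2,[::3;0;0;1;8]); (103,4,[::0;1;2;6;6]); (58,2,[::7;0;1;2;2]); (8,1,[::3;0;1;2;7]);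
  (46,4,[::8;1;0;2;4]); (121,1,[::0;0;2;3;8]); (489,4,[::1;1;2;5;6]); (313,1,[::3;0;2;4;4]);
  (69,3,[::3;0;2;2;4]); (94,4,[::2;1;2;3;7]); (949,4,[::4;1;1;3;6]); (968,1,[::6;0;0;0;7]);
  (835,3,[::2;0;0;2;7]); (85,3,[::2;0;0;3;6]); (786,1,[::5;0;2;2;4]); (48,4,[::2;1;0;6;6]);
  (1076,1,[::0;0;0;5;8]); (955,4,[::1;1;1;2;10]); (18,1,[::3;1;0;3;6]); (84,4,[::0;1;4;4;6]);
  (31,4,[::0;1;2;2;10]); (48,3,[::0;0;1;5;5]); (569,2,[::6;0;0;3;3]); (324,4,[::2;1;3;3;6]);
  (1070,1,[::5;0;0;2;6]); (150,4,[::7;1;2;2;3]); (2,1,[::1;0;0;0;12]); (550,4,[::2;1;1;5;6]);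
  (221,3,[::6;0;0;2;3]); (146,4,[::4;1;2;3;5]); (461,1,[::7;0;0;0;6]); (164,3,[::1;0;3;3;4]);
  (110,1,[::8;0;1;2;2]); (825,2,[::0;0;2;3;7]); (231,4,[::9;1;0;2;3]); (566,1,[::5;0;0;4;4]);
  (1781,1,[::0;0;0;4;9]); (390,3,[::4;0;0;2;5]); (12,2,[::6;0;0;1;5]); (161,4,[::4;1;3;3;4]);
  (82,4,[::5;1;3;3;3]); (140,1,[::5;0;2;3;3]); (236,4,[::9;1;1;1;3]); (388,2,[::3;0;2;2;5]);
  (2,4,[::0;1;1;1;12]); (564,2,[::0;0;3;4;5]); (11,2,[::3;0;1;2;6]); (158,1,[::4;0;0;3;6]);
  (168,1,[::1;0;2;4;6]); (638,1,[::4;0;0;4;5]); (5,1,[::3;0;0;0;10]); (869,2,[::4;0;0;3;5]);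
  (6,1,[::7;1;0;0;5]); (38,3,[::1;0;1;4;5]); (118,1,[::3;0;0;2;8]); (955,4,[::3;1;1;2;8]);
  (1136,1,[::2;0;2;2;7]); (985,3,[::2;0;0;0;9]); (2,2,[::2;0;1;1;8]); (41,3,[::8;0;1;1;1]);
  (66,1,[::6;0;1;2;4]); (604,4,[::4;1;2;4;4]); (18,2,[::5;0;0;0;7]); (102,4,[::4;1;1;4;5]);
  (527,4,[::3;1;2;3;6]); (255,4,[::6;1;2;2;4]); (444,3,[::5;0;0;0;6]); (707,4,[::2;1;1;3;8]);
  (1076,3,[::0;0;0;5;6]); (1498,1,[::7;0;0;2;4]); (669,2,[::3;0;0;4;5]); (231,2,[::2;0;2;4;4]);
  (37,2,[::2;0;0;4;6]); (213,2,[::3;0;3;3;3]); (68,3,[::3;0;0;4;4]); (254,4,[::3;1;3;3;5]);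
  (55,3,[::2;0;2;2;5]); (19,4,[::1;1;3;5;5]); (6,2,[::3;0;0;3;6]); (1781,3,[::0;0;0;2;9]);
  (418,1,[::2;0;2;3;6]); (5,4,[::5;1;1;1;7]); (12,4,[::7;1;0;2;5]); (523,4,[::7;1;1;3;3]);
  (9,1,[::6;1;0;2;4]); (46,4,[::2;1;2;5;5]); (35,3,[::5;0;0;1;5]); (945,4,[::7;1;1;2;4]);
  (1324,1,[::6;0;0;2;5]); (89,4,[::3;1;2;4;5]); (8,3,[::3;0;1;1;6]); (131,4,[::0;1;2;4;8]);
  (692,3,[::2;0;0;4;5]); (1007,2,[::2;0;0;3;7]); (29,3,[::4;0;1;3;3]); (231,3,[::8;0;0;1;2]);
  (945,1,[::8;0;0;0;5]); (84,3,[::3;0;0;1;7]); (1269,1,[::8;0;0;2;3]); (272,4,[::5;1;2;3;4]);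
  (353,2,[::0;0;0;5;7]); (928,3,[::8;0;0;0;3]); (59,1,[::7;0;1;2;3]); (455,2,[::8;0;0;0;4])].

Definition cert_slab : certificate := [::
  (137,4,[::2;1;1;3;6]); (408,1,[::0;0;0;0;11]); (50,2,[::0;2;2;2;4]); (384,1,[::2;0;0;0;9]);
  (67,2,[::4;0;2;2;2]); (203,1,[::0;0;0;5;6]); (3,1,[::1;0;2;3;5]); (213,2,[::1;0;2;2;5]);
  (18,2,[::0;2;2;3;3]); (410,2,[::0;0;0;5;5]); (13,2,[::1;0;0;0;9]); (100,2,[::0;0;1;2;7]);
  (83,1,[::1;0;1;3;6]); (62,3,[::0;0;0;4;5]); (107,1,[::5;0;2;2;2]); (89,3,[::3;0;2;2;2]);
  (50,1,[::0;0;1;2;8]); (311,3,[::5;0;0;2;2]); (8,3,[::2;0;1;3;3]); (43,2,[::0;1;3;3;3]);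
  (17,4,[::3;1;2;3;4]); (359,3,[::0;0;0;0;9]); (93,4,[::9;1;1;1;1]); (150,1,[::0;0;1;4;6]);
  (17,1,[::9;0;0;0;2]); (50,2,[::1;0;0;2;7]); (90,1,[::6;0;0;1;4]); (23,1,[::3;0;1;1;6]);
  (30,1,[::8;0;0;0;3]); (124,4,[::1;2;2;4;4]); (1092,1,[::0;0;2;4;5]); (32,1,[::0;1;2;3;5]);
  (304,2,[::3;0;0;0;7]); (189,2,[::0;1;2;2;5]); (339,1,[::4;0;0;3;4]); (1061,1,[::0;0;2;2;7]);
  (101,4,[::1;1;1;2;8]); (200,2,[::5;0;0;2;3]); (202,1,[::3;0;0;4;4]); (200,2,[::5;0;1;2;2]);
  (14,3,[::0;0;1;1;7]); (51,1,[::8;0;0;1;2]); (39,1,[::2;0;0;1;8]); (67,1,[::1;0;0;4;6]);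
  (95,1,[::2;0;1;3;5]); (281,4,[::2;1;1;1;8]); (2,2,[::4;0;0;3;3]); (408,4,[::7;1;1;1;3]);
  (237,4,[::3;1;1;4;4]); (9,2,[::1;0;0;3;6]); (85,3,[::0;2;2;2;3]); (947,3,[::0;0;0;2;7]);
  (371,1,[::0;0;3;4;4]); (1022,1,[::0;0;0;4;7]); (155,4,[::2;2;2;3;4]); (102,1,[::6;0;0;2;3]);
  (683,1,[::2;0;2;3;4]); (1020,1,[::2;0;0;2;7]); (9,1,[::0;1;1;4;5]); (403,1,[::3;0;2;2;4]);
  (39,4,[::4;2;2;2;3]); (37,3,[::2;0;0;0;7]); (228,1,[::0;0;2;3;6]); (30,1,[::6;0;0;0;5]);
  (122,3,[::2;0;2;2;3]); (3,4,[::5;1;1;2;4]); (10,2,[::2;0;0;4;4]); (71,3,[::3;0;0;3;3]);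
  (133,2,[::0;0;1;4;5]); (24,2,[::3;1;2;2;2]); (383,3,[::0;0;2;2;5]); (245,1,[::2;0;2;2;5]);
  (14,3,[::8;0;0;0;1]); (13,1,[::1;0;0;0;10]); (125,3,[::1;0;0;3;5]); (178,2,[::2;0;2;2;4]);
  (50,1,[::1;0;2;2;6]); (276,2,[::2;0;0;3;5]); (377,1,[::4;0;0;2;5]); (114,1,[::3;0;0;2;6]);
  (191,4,[::2;1;2;4;4]); (80,1,[::4;0;0;0;7]); (13,1,[::1;0;3;3;4]); (210,2,[::2;1;2;2;3]);
  (147,1,[::2;0;0;3;6]); (39,1,[::1;2;2;3;3]); (75,2,[::1;0;0;4;5]); (75,1,[::4;0;0;1;6]);
  (150,2,[::5;0;0;1;4]); (233,3,[::0;0;1;3;5]); (13,1,[::2;1;1;3;4]); (188,1,[::1;0;2;4;4]);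
  (180,3,[::2;0;0;2;5]); (25,1,[::0;0;0;1;10]); (1150,1,[::0;0;0;2;9]); (15,2,[::4;0;0;1;5]);
  (75,1,[::0;0;0;3;8]); (128,2,[::0;0;0;3;7]); (46,1,[::2;0;3;3;3]); (510,2,[::3;0;0;2;5]);
  (400,2,[::2;0;1;2;5]); (50,2,[::0;0;0;1;9]); (25,1,[::3;0;0;0;8]); (26,1,[::3;0;1;3;4]);
  (615,2,[::0;0;2;3;5]); (249,3,[::5;0;0;0;4]); (379,1,[::7;0;0;0;4]); (156,1,[::2;0;1;4;4]);
  (35,1,[::4;1;2;2;2]); (135,3,[::3;0;0;1;5]); (541,4,[::4;1;1;3;4]); (128,1,[::2;0;1;2;6]);
  (329,1,[::5;0;0;0;6]); (528,1,[::2;0;0;4;5]); (378,1,[::4;0;1;2;4]); (32,2,[::1;0;3;3;3]);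
  (92,2,[::2;0;0;1;7]); (50,2,[::5;0;0;0;5]); (141,4,[::4;1;2;2;4]); (304,1,[::4;0;2;2;3]);
  (25,1,[::1;0;0;2;8]); (190,4,[::2;1;2;2;6]); (683,1,[::5;0;0;2;4]); (308,1,[::0;2;2;3;4]);
  (251,4,[::4;1;1;1;6]); (51,4,[::1;2;2;2;6]); (1,4,[::3;1;3;3;3]); (6,1,[::3;2;2;2;2]);
  (7,1,[::0;1;3;3;4]); (44,4,[::3;2;2;2;4]); (14,1,[::1;0;1;1;8]); (8,1,[::4;1;1;1;4]);
  (50,1,[::0;1;2;2;6]); (50,1,[::0;1;1;3;6]); (153,1,[::3;0;2;3;3]); (102,1,[::6;0;1;2;2]);
  (589,4,[::1;1;1;4;6]); (436,4,[::1;1;3;4;4]); (38,3,[::0;0;3;3;3]); (119,1,[::0;2;2;2;5]);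
  (25,1,[::3;1;2;2;3]); (562,1,[::7;0;0;2;2]); (362,2,[::8;0;0;0;2]); (164,1,[::0;1;2;4;4])].

Definition cert_2 : certificate := [::
  (5,1,[::0;0;0;0;1])].

Definition cert_4 : certificate := [::
  (5,1,[::0;0;0;0;3]); (10,1,[::0;0;0;1;2]); (1,4,[::1;1;1;1;1])].

Definition cert_7 : certificate := [::
  (35,1,[::0;0;0;0;6]); (45,3,[::0;0;0;2;2]); (70,1,[::0;0;2;2;2]); (20,2,[::0;0;0;1;4]);
  (105,1,[::0;0;0;2;4]); (10,1,[::0;1;1;1;3]); (10,1,[::0;0;0;3;3]); (18,3,[::0;0;0;0;4]);
  (25,4,[::1;1;1;2;3]); (15,1,[::0;0;0;1;5]); (15,2,[::0;0;0;2;3])].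

Definition cert_8 : certificate := [::
  (90,2,[::0;0;1;2;3]); (55,1,[::0;0;0;0;7]); (60,2,[::0;0;0;1;5]); (10,4,[::1;1;1;2;4]);
  (30,3,[::0;0;0;2;3]); (10,3,[::0;0;0;0;5]); (130,1,[::0;0;0;2;5]); (90,1,[::0;0;0;3;4]);
  (90,1,[::0;0;1;2;4]); (105,1,[::0;0;2;2;3]); (30,1,[::0;0;0;1;6]); (20,2,[::0;0;0;3;3]);
  (45,3,[::0;0;1;1;3]); (40,1,[::0;1;2;2;2]); (10,2,[::0;0;2;2;2]); (15,4,[::1;2;2;2;2])].

Definition cert_9 : certificate := [::
  (10,3,[::0;0;0;0;6]); (15,1,[::0;0;0;0;8]); (5,3,[::0;1;1;2;2]); (10,4,[::1;1;1;2;5]);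
  (20,1,[::0;0;0;4;4]); (5,1,[::0;0;0;1;7]); (50,1,[::0;0;0;2;6]); (10,1,[::0;0;0;3;5]);
  (35,3,[::0;0;0;2;4]); (5,2,[::0;0;2;2;3]); (15,3,[::0;0;2;2;2]); (5,4,[::1;1;1;3;4]);
  (5,2,[::0;0;0;1;6]); (5,1,[::0;1;1;1;5]); (75,1,[::0;0;2;2;4]); (10,1,[::0;0;2;3;3]);
  (10,2,[::0;1;1;2;3]); (15,1,[::0;0;1;2;5]); (10,2,[::0;0;0;3;4]); (10,1,[::0;2;2;2;2]);
  (10,1,[::0;1;1;3;3])].

Definition cert_10 : certificate := [::
  (39,1,[::0;1;1;1;6]); (12,1,[::1;1;1;2;4]); (244,1,[::0;0;2;3;4]); (56,1,[::0;0;0;1;8]);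
  (16,1,[::0;0;3;3;3]); (140,1,[::0;2;2;2;3]); (6,1,[::0;0;1;4;4]); (152,1,[::0;0;0;2;7]);
  (112,1,[::0;0;0;3;6]); (55,2,[::0;0;0;3;5]); (130,1,[::0;0;2;2;5]); (43,4,[::1;1;2;3;4]);
  (14,1,[::1;2;2;2;2]); (17,1,[::1;1;1;3;3]); (73,2,[::0;0;0;1;7]); (28,2,[::1;1;1;2;3]);
  (6,2,[::0;0;2;3;3]); (119,3,[::0;0;2;2;3]); (114,1,[::0;0;0;4;5]); (118,1,[::0;0;1;2;6]);
  (70,1,[::0;0;0;0;9]); (32,2,[::0;1;1;1;5]); (27,2,[::0;0;0;4;4]); (17,2,[::0;0;0;2;6]);
  (165,2,[::0;0;1;3;4]); (6,3,[::0;0;0;0;7]); (140,1,[::0;1;2;2;4]); (173,2,[::0;0;1;2;5])].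

Definition cert_12 : certificate := [::
  (246,1,[::0;2;2;2;5]); (170,1,[::0;0;0;0;11]); (78,3,[::0;0;3;3;3]); (101,1,[::0;0;1;4;6]);
  (932,1,[::0;0;2;2;7]); (154,3,[::0;0;0;0;9]); (113,4,[::2;2;2;3;4]); (12,1,[::0;0;0;1;10]);
  (647,1,[::0;0;0;2;9]); (34,1,[::0;0;0;3;8]); (77,4,[::1;2;2;2;6]); (200,1,[::0;0;0;5;6]);
  (134,1,[::0;0;2;3;6]); (596,2,[::0;0;2;3;5]); (53,3,[::0;1;1;2;5]); (456,3,[::0;0;0;2;7]);
  (481,1,[::0;0;0;4;7]); (573,1,[::0;2;2;3;4]); (29,1,[::0;1;3;3;4]); (23,2,[::0;0;0;1;9]);
  (257,4,[::1;1;1;4;6]); (263,1,[::0;0;3;4;4]); (90,4,[::1;1;2;3;6]); (124,2,[::0;1;3;3;3]);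
  (101,2,[::0;0;1;4;5]); (234,1,[::0;1;2;4;4]); (920,1,[::0;0;2;4;5]); (195,4,[::1;1;3;4;4]);
  (58,2,[::1;2;2;2;3]); (67,1,[::0;1;2;2;6]); (141,2,[::0;0;0;5;5]); (292,3,[::0;0;2;2;5]);
  (158,4,[::1;1;1;2;8]); (67,2,[::0;2;2;2;4]); (91,1,[::0;1;1;3;6]); (166,2,[::0;0;0;3;7]);
  (239,2,[::0;1;2;2;5]); (34,1,[::0;0;1;2;8]); (191,3,[::0;0;1;3;5]); (72,4,[::1;3;3;3;3]);
  (43,2,[::0;0;1;2;7]); (214,4,[::1;2;2;4;4]); (13,3,[::0;0;1;1;7]); (55,3,[::1;1;1;3;3]);
  (133,3,[::0;0;0;4;5]); (99,1,[::0;2;3;3;3])].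

Definition cert_14 : certificate := [::
  (230,1,[::0;0;0;0;13]); (3,1,[::0;0;0;1;12]); (227,3,[::0;0;0;0;11]); (2136,1,[::0;0;2;4;7]);
  (87,1,[::0;0;3;5;5]); (512,1,[::0;2;3;4;4]); (460,1,[::0;0;0;6;7]); (220,2,[::0;1;3;3;5]);
  (491,2,[::0;2;2;3;5]); (914,1,[::0;0;0;2;11]); (7,1,[::0;0;0;3;10]); (108,4,[::1;1;2;5;6]);
  (235,1,[::0;0;0;5;8]); (111,1,[::2;2;2;3;4]); (69,3,[::0;1;1;2;7]); (97,1,[::0;1;2;4;6]);
  (357,4,[::1;1;2;3;8]); (474,3,[::0;0;3;3;5]); (552,2,[::0;0;2;5;5]); (69,3,[::0;0;1;3;7]);
  (96,1,[::1;3;3;3;3]); (3,2,[::0;0;4;4;4]); (224,4,[::1;1;1;2;10]); (509,2,[::0;0;2;3;7]);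
  (22,4,[::2;2;3;3;5]); (207,1,[::0;2;2;3;6]); (10,4,[::1;2;2;2;8]); (28,1,[::0;0;2;3;8]);
  (55,1,[::0;1;3;3;6]); (5,2,[::0;0;0;1;11]); (226,2,[::0;0;0;5;7]); (61,2,[::1;1;1;4;5]);
  (449,3,[::0;0;2;4;5]); (305,4,[::2;2;3;4;4]); (497,1,[::0;0;4;4;5]); (4,4,[::2;2;2;2;7]);
  (684,3,[::0;0;0;2;9]); (159,3,[::0;0;0;5;6]); (7,1,[::0;0;1;2;10]); (686,1,[::0;0;0;4;9]);
  (1367,1,[::0;0;2;2;9]); (647,4,[::1;2;2;4;6]); (7,3,[::0;0;1;1;9]); (60,2,[::0;2;2;4;4]);
  (99,1,[::0;2;3;3;5]); (14,1,[::0;1;2;2;8]); (117,1,[::0;0;3;4;6]); (21,1,[::0;0;1;4;8]);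
  (409,4,[::1;2;4;4;4]); (249,1,[::0;1;1;5;6]); (228,2,[::0;0;0;3;9]); (114,1,[::0;0;1;6;6]);
  (829,1,[::0;2;2;2;7]); (845,3,[::0;0;2;2;7]); (84,4,[::1;1;1;6;6]); (625,1,[::0;0;2;5;6]);
  (28,1,[::0;1;1;3;8]); (50,3,[::1;1;3;3;3]); (135,2,[::0;3;3;3;3]); (293,2,[::0;0;3;4;5]);
  (90,3,[::0;0;1;5;5]); (142,2,[::1;2;2;2;5]); (399,4,[::1;1;1;4;8]); (1321,1,[::0;2;2;4;5]);
  (454,3,[::0;0;0;4;7]); (632,4,[::1;1;3;4;6]); (86,1,[::2;2;2;2;5]); (332,3,[::0;2;2;2;5]);
  (45,2,[::2;2;2;3;3])].

Definition cert_6_in : certificate := [::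
  (3,1,[::0;0;0;2;3]); (3,1,[::0;0;0;3;2]); (3,1,[::3;0;0;2;0]); (6,2,[::0;0;1;3;0]);
  (3,1,[::0;0;0;4;1]); (3,1,[::2;0;0;3;0]); (2,4,[::1;1;1;1;3]); (1,1,[::4;0;0;0;1]);
  (3,1,[::0;0;0;1;4]); (6,1,[::0;0;1;2;2]); (6,1,[::0;0;2;3;0]); (2,3,[::0;1;1;1;0]);
  (3,1,[::1;0;0;2;2]); (1,1,[::1;0;0;0;4]); (1,1,[::3;0;0;0;2]); (3,2,[::1;0;0;3;0]);
  (1,1,[::2;0;0;0;3]); (3,1,[::2;0;0;1;2]); (6,4,[::2;0;2;2;1]); (3,4,[::4;0;0;2;1])].

Definition cert_6_out : certificate := [::
  (10,1,[::0;0;0;1;4]); (10,1,[::0;0;0;2;3]); (2,4,[::1;1;1;2;2]); (2,2,[::0;0;0;2;2]);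
  (10,1,[::0;0;1;2;2]); (1,1,[::1;1;1;1;1])].

(** * Tight boxes and slabs *)

Lemma near_tight_5222_odd r : odd r ->
  near_tight [:: Some 5; Some 2; Some 2; Some 2] r 0.
Proof.
have certified k M cert B :
    [&& check (slice [:: Some 5; Some 2; Some 2; Some 2] k)
              (slice_symmetries [:: Some 5; Some 2; Some 2; Some 2] k) M cert B
      & 5 * B <= size (slice [:: Some 5; Some 2; Some 2; Some 2] k)] ->
    near_tight [:: Some 5; Some 2; Some 2; Some 2] k 0.
  by case/andP => chk le_B; apply: near_tight_check chk _; rewrite addn0.
(* [7 = 4 + 1 + 1 + 1] is the largest sum of the bounded coordinates; from there on the box no
   longer depends on the degree. *)
have tight7 : near_tight [:: Some 5; Some 2; Some 2; Some 2] 7 0.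
  by apply: (certified _ 1 cert_5222_7 8); vm_compute.
move=> odd_r; case: (leqP 7 r) => [ge7 | lt7].
  exact: (@near_tight_full [:: 5; 2; 2; 2] 7).
case: r odd_r lt7 => [|[|[|[|[|[|[|r]]]]]]] // _ _.
- by apply: (certified _ 1 cert_5222_1 1); vm_compute.
- by apply: (certified _ 1 cert_5222_3 4); vm_compute.
- by apply: (certified _ 1 cert_5222_5 7); vm_compute.
Qed.

(** [Q] is the set of degrees met while slabs of thickness [n] are removed. The left alternative is
    a base case, settled directly. *)
Lemma near_tight_peel pre n post (e : nat) (Q : nat -> Prop) r : size pre < 5 -> 0 < n ->
    (forall r, Q r -> near_tight (pre ++ None :: post) r e \/
       near_tight (pre ++ Some n :: post) r 0 /\ (n <= r -> Q (r - n))) ->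
  Q r -> near_tight (pre ++ None :: post) r e.
Proof.
move=> lt_pre n_gt0 step; elim/ltn_ind: r => r IHr /step [// | [tight_r Qrn]].
apply: (@near_tight_split pre n post None) => // le_nr.
by apply: IHr (Qrn le_nr); lia.
Qed.

(** Cuts of thickness 2 keep the degree odd, so the three free directions can be cut one after
    another down to the boxes. *)
Lemma near_tight_slab5_odd r : odd r -> near_tight [:: Some 5; None; None; None] r 0.
Proof.
have peel pre post : size pre < 5 ->
    (forall r, odd r -> near_tight (pre ++ Some 2 :: post) r 0) ->
    forall r, odd r -> near_tight (pre ++ None :: post) r 0.
  move=> lt_pre tight2 k odd_k; apply: (@near_tight_peel pre 2 post 0 odd) => // m odd_m.
  by right; split=> [|le2m]; [exact: tight2 | rewrite oddB // odd_m].
move: r; apply: (peel [:: Some 5] [:: None; None]) => //.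
apply: (peel [:: Some 5; Some 2] [:: None]) => //.
by apply: (peel [:: Some 5; Some 2; Some 2] [::]) near_tight_5222_odd.
Qed.

(** The box is cut into two boxes of side 5, of degrees [r] and [r - 5]. One of these is even, hence
    the need for [r - 5 >= 7], where parity no longer matters. *)
Lemma near_tight_box10222 r : 12 <= r -> near_tight [:: Some 10; Some 2; Some 2; Some 2] r 0.
Proof.
have tight5 k : 7 <= k -> near_tight [:: Some 5; Some 2; Some 2; Some 2] k 0.
  by move=> ge7; apply: (@near_tight_full [:: 5; 2; 2; 2] 7) => //; apply: near_tight_5222_odd.
move=> ge12; apply: (@near_tight_split [::] 5 _ (Some 10)) => // [|_]; apply: tight5; lia.
Qed.

(* The boxes 5 x 2 x 2 x 2 of even degree r < 7 are not tight, so the peeling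
   by 2 has to start from larger regions. *)
Lemma near_tight_slab10_even r : ~~ odd r -> 12 <= r ->
  near_tight [:: Some 10; None; None; None] r 0.
Proof.
have prism k : ~~ odd k && (14 <= k) -> near_tight [:: Some 10; Some 2; Some 2; None] k 0.
  apply: (@near_tight_peel [:: Some 10; Some 2; Some 2] 2 [::] 0
           (fun m => ~~ odd m && (14 <= m))) => // m /andP [even_m ge14].
  (* The three regions certified in this proof have 380, 1185 and 1805 points, exactly five times
     the respective bounds, so they are tight without error. *)
  have [-> | neq14] := eqVneq m 14.
    by left; apply: (@near_tight_check _ _ _ 2 cert_prism 76); vm_compute.
  by right; split=> [|_]; [apply: near_tight_box10222; lia | lia].
have slab2 k : ~~ odd k && (14 <= k) -> near_tight [:: Some 10; Some 2; None; None] k 0.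
  apply: (@near_tight_peel [:: Some 10; Some 2] 2 [:: None] 0
           (fun m => ~~ odd m && (14 <= m))) => // m /andP [even_m ge14].
  have [-> | neq14] := eqVneq m 14.
    by left; apply: (@near_tight_check _ _ _ 476 cert_slab2 237); vm_compute.
  by right; split=> [|_]; [apply: prism; lia | lia].
move=> even_r ge12; have : ~~ odd r && (12 <= r) by rewrite even_r.
apply: (@near_tight_peel [:: Some 10] 2 [:: None; None] 0
         (fun m => ~~ odd m && (12 <= m))) => // m /andP [even_m ge12m].
have [-> | neq12] := eqVneq m 12.
  by left; apply: (@near_tight_check _ _ _ 102 cert_slab 361); vm_compute.
by right; split=> [|_]; [apply: slab2; lia | lia].
Qed.

(** * The upper bound on the whole simplex *)

Definition simplex (d : nat) : seq (seq nat) := slice (nseq 4 None) d.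

Lemma mem_slice_free k r l :
  (l \in slice (nseq k None) r) = (size l == k.+1) && (sumn l == r).
Proof.
elim: k r l => [|k IHk] r l.
  case: l => [|a [|b l]] //=; rewrite inE ?addn0; last by apply/eqP.
  by apply/eqP/eqP => [[] | ->].
apply/idP/andP => [/allpairsPdep [a [l' [a_r l'_r ->]]] | [/eqP sz_l /eqP sum_l]].
  move: l'_r a_r; rewrite IHk mem_iota /= => /andP [/eqP -> /eqP ->] lt_a.
  by rewrite eqxx; split=> //; apply/eqP; lia.
case: l sz_l sum_l => [//|a l] [sz_l]; rewrite [sumn _]/= => sum_l.
apply/flatten_mapP; exists a; first by rewrite mem_iota /=; lia.
by apply: map_f; rewrite IHk sz_l eqxx /=; apply/eqP; lia.
Qed.

Lemma uniq_slice ns r : uniq (slice ns r).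
Proof.
elim: ns r => [|n ns IHns] r //=; apply: allpairs_uniq_dep; first exact: iota_uniq.
  by move=> a _; apply: IHns.
by move=> [a l] [b m] _ _ /= [-> ->].
Qed.

Lemma size_slice_free k r : size (slice (nseq k None) r) = 'C(r + k, k).
Proof.
elim: k r => [|k IHk] r; first by rewrite bin0.
have -> : size (slice (nseq k.+1 None) r) = \sum_(0 <= a < r.+1) 'C(r - a + k, k).
  rewrite -count_predT [nseq _ _]/= count_slice_cons; apply: eq_bigr => a _.
  by rewrite -IHk -count_predT.
(* Summing over the first coordinate leaves the hockey-stick identity, an induction by Pascal's
   rule. *)
elim: r => [|r IHr]; first by rewrite big_nat1 !add0n !binn.
rewrite big_nat_recl // subn0 (eq_bigr _ (fun a _ => erefl)) /= IHr.
by rewrite -addSnnS [in RHS]addnS [in RHS]binS addnC.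
Qed.

Lemma size_simplex d : size (simplex d) = 'C(d + 4, 4).
Proof. exact: size_slice_free. Qed.

Lemma mem_simplex d l : (l \in simplex d) = (size l == 5) && (sumn l == d).
Proof. exact: mem_slice_free. Qed.

Definition adjacent (a l : seq nat) : bool :=
  has (fun i => has (fun j => (i != j) && (incr_nth l i == incr_nth a j)) (iota 0 5)) (iota 0 5).

Lemma count_filterC (T : Type) (f p : pred T) s :
  count f s = count f (filter p s) + count f (filter (predC p) s).
Proof.
rewrite !count_filter; elim: s => //= x s ->.
by case: (f x); case: (p x) => //=; rewrite ?addnS ?addSn.
Qed.

Lemma count_notin (T : eqType) (f : pred T) s t : ~~ has f t ->
  count f s = count f [seq x <- s | x \notin t].
Proof.
move=> /hasPn notf; rewrite count_filter; apply: eq_count => x /=.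
by case: (boolP (x \in t)) => [/notf/negPf -> | _]; rewrite ?andbF ?andbT.
Qed.

(** Choosing [a] excludes all its neighbours, so of the points dropped by the filter only [a] itself
    counts. *)
Lemma count_avoid f a d (s : seq (seq nat)) : indep f -> f a -> size a = 5 ->
    subseq s (simplex d) ->
  count f s <= (count f [seq l <- s | (l != a) && ~~ adjacent a l]).+1.
Proof.
move=> ind_f f_a sz_a sub_s.
rewrite (count_filterC _ [pred l | (l != a) && ~~ adjacent a l]) -addn1 leq_add2l.
have uniq_s : uniq s by apply: subseq_uniq sub_s (uniq_slice _ _).
apply: leq_trans (_ : count (pred1 a) s <= 1); last by rewrite count_uniq_mem ?leq_b1.
rewrite count_filter -!size_filter; apply: uniq_leq_size; first exact: filter_uniq.
move=> l; rewrite !mem_filter /= => /andP [] /andP [f_l l_near] l_s; rewrite l_s andbT.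
move: l_near; rewrite negb_and !negbK => /orP [// | /hasP [i i_5 /hasP [j j_5]]].
case/andP=> neq_ij /eqP eq_la; move: i_5 j_5; rewrite !mem_iota => lt_i lt_j.
have := mem_subseq sub_s l_s; rewrite mem_simplex => /andP [/eqP sz_l _].
by case: (ind_f l a i j).
Qed.

Lemma near_tight_simplex6 : near_tight (nseq 4 None) 6 0.
Proof.
move=> f ind_f; suff : count f (simplex 6) <= 42.
  have -> : size (slice (nseq 4 None) 6) = 210 by rewrite size_slice_free.
  by rewrite /simplex; lia.
rewrite (count_filterC _ (all (leq^~ 4))).
set Q := filter _ _; set Q' := filter _ _.
(* [Q'] is the union of the five corner cliques. *)
have leQ' : count f Q' <= 5.
  by apply: (@check_sound _ (permutations (iota 0 5)) 1 [:: (5, 1, [:: 5; 0; 0; 0; 0])]) ind_f;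
     vm_compute.
(* The target is [42 = 5 + 37]. If a point of the orbit is chosen, [37 = 1 + 36]; otherwise the
   whole orbit is deleted from [Q]. *)
suff : count f Q <= 37 by lia.
pose perms := permutations (iota 0 5).
pose orbit := [seq perm_coords 0 [:: 3; 1; 1; 1; 0] h | h <- perms].
have [/hasP [a /mapP [h h_in ->] f_a] | no_a] := boolP (has f orbit).
  set b := perm_coords _ _ _ in f_a.
  (* The certificate is written for (3,1,1,1,0). Composing the stabiliser of this point with [h]
     carries it to the permuted point. *)
  have /allP /(_ h h_in) : all (fun h => (size h == 5) &&
      check [seq l <- Q | (l != perm_coords 0 [:: 3; 1; 1; 1; 0] h)
                          && ~~ adjacent (perm_coords 0 [:: 3; 1; 1; 1; 0] h) l]
            [seq perm_coords 0 g h | g <- symmetries [:: 3; 1; 1; 1; 0]] 2 cert_6_in 36) perms.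
    by vm_compute.
  case/andP=> /eqP sz_h chk; apply: leq_trans (count_avoid ind_f f_a _ _) _.
  - by rewrite size_map.
  - exact: filter_subseq.
  - by rewrite ltnS; apply: check_sound chk ind_f.
rewrite (count_notin Q no_a).
by apply: (@check_sound _ perms 1 cert_6_out) ind_f; vm_compute.
Qed.

(** Induction on the degree: a tight slab of thickness 5 or 10 is removed. The degrees treated
    separately are those where this would leave degree 2 or 4, and small even ones where no tight
    slab is at hand. *)
Lemma near_tight_simplex d : d != 2 -> d != 4 -> near_tight (nseq 4 None) d 4.
Proof.
elim/ltn_ind: d => d IHd neq2 neq4.
have slab n : near_tight [:: Some n; None; None; None] d 0 ->
    (n <= d -> [/\ 0 < n, d - n != 2 & d - n != 4]) -> near_tight (nseq 4 None) d 4.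
  move=> tight_d ok; apply: (@near_tight_split [::] n _ None) => // le_nd.
  by have [n_gt0 ? ?] := ok le_nd; apply: IHd => //; lia.
case: (boolP (odd d)) => odd_d.
  (* The degrees 7 and 9 would descend to the exceptional 2 and 4. *)
  have [-> | neq7] := eqVneq d 7.
    by apply: (@near_tight_check _ _ _ 7 cert_7 66); vm_compute.
  have [-> | neq9] := eqVneq d 9.
    by apply: (@near_tight_check _ _ _ 3 cert_9 143); vm_compute.
  apply: (slab 5); first exact: near_tight_slab5_odd.
  by move=> le5d; split=> //; apply/eqP; lia.
(* From 16 on, [d - 10] is at least 6; 12 and 14 would descend to 2 and 4. *)
have [le_d | gt_d] := leqP 16 d.
  apply: (slab 10); first by apply: near_tight_slab10_even => //; lia.
  by move=> _; split=> //; apply/eqP; lia.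
have : d \in [:: 0; 6; 8; 10; 12; 14].
  by move: gt_d neq2 neq4 odd_d; clear; do 16 (case: d => [// | d]).
rewrite !inE => /orP [/eqP -> | /orP [/eqP -> | /orP [/eqP -> | /orP [/eqP -> | /orP [] /eqP ->]]]].
(* The single point of degree 0 uses up the whole error: [5 * 1 = 1 + 4]. *)
- by move=> f _; have := count_size f (slice (nseq 4 None) 0); rewrite /=; lia.
- by move=> f ind_f; have := near_tight_simplex6 ind_f; lia.
- by apply: (@near_tight_check _ _ _ 11 cert_8 99); vm_compute.
(* There are 1001 points here, and [5 * 201 = 1001 + 4]; in the other certified degrees the size is
   five times the bound. *)
- by apply: (@near_tight_check _ _ _ 14 cert_10 201); vm_compute.
- by apply: (@near_tight_check _ _ _ 34 cert_12 364); vm_compute.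
- by apply: (@near_tight_check _ _ _ 46 cert_14 612); vm_compute.
Qed.

Lemma count_simplex2 f : indep f -> count f (simplex 2) <= 5.
Proof. by apply: (@check_sound _ (permutations (iota 0 5)) 1 cert_2); vm_compute. Qed.

(** After normalisation the cover has weight 1 on the stars at [3 e_i], 1/2 on those at
    [2 e_i + e_j], and 1 on the clique of permutations of (1,1,1,1,0): in total [5 + 10 + 1]. *)
Lemma count_simplex4 f : indep f -> count f (simplex 4) <= 16.
Proof. by apply: (@check_sound _ (permutations (iota 0 5)) 1 cert_4); vm_compute. Qed.

(** * Transfer between the graph and coordinate lists *)

Section Points.
Variable d : nat.

Definition coords (a : point 5 d) : seq nat := [seq val (a i) | i <- enum 'I_5].

Lemma size_coords a : size (coords a) = 5.
Proof. by rewrite size_map size_enum_ord. Qed.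

Lemma nth_coords a (i : 'I_5) : nth 0 (coords a) i = a i.
Proof. by rewrite (nth_map i) ?size_enum_ord // nth_ord_enum. Qed.

Lemma sumn_coords a : sumn (coords a) = \sum_i a i.
Proof. by rewrite sumnE big_map big_enum. Qed.

Lemma coords_inj : injective coords.
Proof.
move=> a b eq_ab; apply/ffunP => i; apply: val_inj.
by have := congr1 (nth 0 ^~ i) eq_ab; rewrite !nth_coords.
Qed.

Lemma mem_map_coords l : (l \in [seq coords a | a <- enum (Delta 5 d)]) = (l \in simplex d).
Proof.
rewrite mem_simplex; apply/mapP/andP => [[a] | [/eqP sz_l /eqP sum_l]].
  rewrite mem_enum inE => /eqP sum_a ->.
  by rewrite size_coords sumn_coords sum_a !eqxx.
have le_l i : i < 5 -> nth 0 l i < d.+1.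
  rewrite -sz_l ltnS -sum_l => lt_i; rewrite sumnE (big_nth 0) big_mkord.
  by rewrite (bigD1 (Ordinal lt_i)) //= leq_addr.
pose a : point 5 d := [ffun i => Ordinal (le_l _ (ltn_ord i))].
have eq_l : l = coords a.
  apply: (@eq_from_nth _ 0) => [|i]; first by rewrite size_coords.
  by rewrite sz_l => lt_i; rewrite (nth_coords a (Ordinal lt_i)) ffunE.
by exists a; rewrite // mem_enum inE -sumn_coords -eq_l sum_l.
Qed.

Lemma card_Delta_count p : #|[set a in Delta 5 d | p (coords a)]| = count p (simplex d).
Proof.
have /permP <- : perm_eq [seq coords a | a <- enum (Delta 5 d)] (simplex d).
  apply: uniq_perm mem_map_coords; last exact: uniq_slice.
  by rewrite (map_inj_uniq coords_inj) enum_uniq.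
rewrite count_map -sum1_count big_enum_cond -sum1dep_card.
by apply: eq_bigl => a; rewrite inE.
Qed.

Lemma adj_coords a b :
  adj a b = [exists i : 'I_5, exists j : 'I_5,
    (i != j) && (incr_nth (coords a) j == incr_nth (coords b) i)].
Proof.
have diffE (i j : 'I_5) : i != j ->
    (zvec a - zvec b == unit_vec i - unit_vec j)%R =
    (incr_nth (coords a) j == incr_nth (coords b) i).
  move=> neq_ij; apply/eqP/eqP => [/rowP eq_ab | eq_ab].
    apply: (@eq_from_nth _ 0) => [|k]; rewrite !size_incr_nth !size_coords !ltn_ord // => lt_k.
    have := eq_ab (Ordinal lt_k); rewrite !mxE !nth_incr_nth.
    rewrite (nth_coords a (Ordinal lt_k)) (nth_coords b (Ordinal lt_k)).
    rewrite !natz -!val_eqE /= !(eq_sym k).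
    by case: eqP => _; case: eqP => _; lia.
  apply/rowP => k; have := congr1 (nth 0 ^~ k) eq_ab.
  rewrite !mxE !nth_incr_nth !nth_coords !natz /= -!val_eqE /= !(eq_sym (nat_of_ord k)).
  by case: eqP => _; case: eqP => _; lia.
apply/andP/existsP => [[_ /existsP [i /existsP [j /andP [neq_ij eq_ij]]]] | [i /existsP [j]]].
  by exists i; apply/existsP; exists j; rewrite neq_ij -diffE.
case/andP=> neq_ij eq_ij; split; last first.
  by apply/existsP; exists i; apply/existsP; exists j; rewrite neq_ij diffE.
(* If [a = b], comparing the coordinates at [i] forces [i = j]. *)
apply: contraNneq neq_ij => eq_ab; move/eqP: eq_ij => /(congr1 (nth 0 ^~ i)).
by rewrite eq_ab !nth_incr_nth eqxx -val_eqE /=; lia.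
Qed.

Lemma alpha_ge (p : pred (seq nat)) : indep p -> count p (simplex d) <= alpha 5 d.
Proof.
move=> ind_p; rewrite -card_Delta_count.
apply: (@leq_bigmax_cond _ _ (fun S : {set point 5 d} => #|S|)).
apply/andP; split; first by apply/subsetP => a; rewrite inE => /andP [].
apply/forall_inP => a; rewrite inE => /andP [_ p_a].
apply/forall_inP => b; rewrite inE => /andP [_ p_b].
rewrite adj_coords; apply/negP => /existsP [i /existsP [j /andP [neq_ij /eqP eq_ab]]].
apply: (ind_p (coords a) (coords b) j i) => //; try exact: size_coords.
by rewrite eq_sym.
Qed.

Lemma alpha_le B : (forall f, indep f -> count f (simplex d) <= B) -> alpha 5 d <= B.
Proof.
move=> le_B; apply/bigmax_leqP => S /andP [/subsetP sub_S /forall_inP ind_S].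
(* [f] is false off the image of [S], so it is independent among lists of every degree. *)
pose f l := [exists a in S, coords a == l].
have fE a : f (coords a) = (a \in S).
  apply/exists_inP/idP => [[b b_S /eqP /coords_inj <- //] | a_S]; by exists a.
have -> : #|S| = count f (simplex d).
  rewrite -card_Delta_count; apply: eq_card => a; rewrite inE fE.
  by case: (boolP (a \in S)) => [/sub_S -> //|]; rewrite andbF.
apply: le_B => l l' i j _ _ lt_i lt_j neq_ij eq_ll'.
move=> /exists_inP [a a_S /eqP eq_a] /exists_inP [b b_S /eqP eq_b].
have /forall_inP /(_ b b_S) := ind_S a a_S; rewrite adj_coords => /negP; apply.
apply/existsP; exists (Ordinal lt_j); apply/existsP; exists (Ordinal lt_i).
by rewrite -val_eqE /= eq_sym neq_ij eq_a eq_b eq_ll' eqxx.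
Qed.

End Points.

(** * Lower bounds *)

Definition colour (l : seq nat) : nat := (\sum_(i < 5) i * nth 0 l i) %% 5.

(** Adding [e_i] raises the weighted sum by [i], so equal colours force [i] and [j] to agree mod 5,
    hence to be equal. *)
Lemma indep_colour c : indep (fun l => colour l == c).
Proof.
move=> l l' i j sz_l sz_l' lt_i lt_j neq_ij eq_ll' /eqP eq_c /eqP eq_c'.
have weightE m k : k < 5 -> \sum_(i < 5) i * nth 0 (incr_nth m k) i =
    k + \sum_(i < 5) i * nth 0 m i.
  move=> lt_k; under eq_bigr => h _ do rewrite nth_incr_nth mulnDr.
  rewrite big_split /=; congr addn.
  rewrite (bigD1 (Ordinal lt_k)) //= eqxx muln1 big1 ?addn0 // => h neq_hk.
  by rewrite eq_sym (negPf (_ : h != k :> nat)) ?muln0.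
have := weightE l i lt_i; rewrite eq_ll' weightE // => eq_w.
move: eq_c eq_c'; rewrite /colour; lia.
Qed.

Lemma alpha_ge_colour d : 'C(d + 4, 4) <= 5 * alpha 5 d.
Proof.
rewrite -size_simplex -count_predT.
have -> : count predT (simplex d) = \sum_(c < 5) count (fun l => colour l == c) (simplex d).
  elim: (simplex d) => [|l s IHs] /=; first by rewrite big1.
  rewrite big_split /= -IHs; congr addn.
  have lt5 : colour l < 5 by rewrite ltn_mod.
  by rewrite (bigD1 (Ordinal lt5)) //= eqxx big1 // => c; rewrite -val_eqE eq_sym => /negPf /= ->.
have -> : 5 * alpha 5 d = \sum_(c < 5) alpha 5 d by rewrite sum_nat_const card_ord.
by apply: leq_sum => c _; apply/alpha_ge/indep_colour.
Qed.

Lemma indep_mem (s : seq (seq nat)) : ~~ has (fun a => has (adjacent a) s) s ->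
  indep (fun l => l \in s).
Proof.
move=> no_adj l l' i j _ _ lt_i lt_j neq_ij eq_ll' l_s l'_s; case/negP: no_adj.
apply/hasP; exists l' => //; apply/hasP; exists l => //.
apply/hasP; exists i; first by rewrite mem_iota.
by apply/hasP; exists j; rewrite ?mem_iota // neq_ij eq_ll' eqxx.
Qed.

Lemma alpha2 : alpha 5 2 = 5.
Proof.
apply/eqP; rewrite eqn_leq alpha_le; last exact: count_simplex2.
pose s := [seq l <- simplex 2 | all (predC odd) l].
have ind_s : indep (fun l => l \in s) by apply: indep_mem; vm_compute.
by apply: leq_trans (alpha_ge 2 ind_s); vm_compute.
Qed.

Lemma alpha4 : alpha 5 4 = 16.
Proof.
apply/eqP; rewrite eqn_leq alpha_le; last exact: count_simplex4.
(* The even points are the 5 points [4 e_i] and the 10 points [2 e_i + 2 e_j]. The extra point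
   differs from each of them in parity at four places, an edge only at two. *)
pose s := [:: 1; 1; 1; 1; 0] :: [seq l <- simplex 4 | all (predC odd) l].
have ind_s : indep (fun l => l \in s) by apply: indep_mem; vm_compute.
by apply: leq_trans (alpha_ge 4 ind_s); vm_compute.
Qed.

(** * The ceiling formula *)

Lemma alpha_le_near d : d != 2 -> d != 4 -> 5 * alpha 5 d <= 'C(d + 4, 4) + 4.
Proof.
move=> neq2 neq4; suff : alpha 5 d <= ('C(d + 4, 4) + 4) %/ 5 by rewrite leq_divRL // mulnC.
apply: alpha_le => f /(near_tight_simplex neq2 neq4).
by rewrite -/(simplex d) size_simplex leq_divRL // mulnC.
Qed.

Import GRing.Theory Num.Theory.
Local Open Scope ring_scope.

Theorem theorem6p6 (d : nat) (hd : (1 <= d)%N) :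
  (alpha 5 d)%:Z =
    (if d == 2%N then 5
     else if d == 4%N then 16
     else Num.ceil (1 / 5 * 'C(d + 4, 4)%:R : rat)).
Proof.
have [-> | neq2] := eqVneq d 2%N; first by rewrite alpha2.
have [-> | neq4] := eqVneq d 4%N; first by rewrite alpha4.
(* The ceiling is characterised by [alpha - 1 < C/5 <= alpha], with [C] the binomial; the strict
   part holds because the error 4 is less than 5. *)
apply/esym/ceil_def; rewrite rmorphB /= -!pmulrn.
have lower : 'C(d + 4, 4)%:R <= 5 * (alpha 5 d)%:R :> rat.
  by rewrite -natrM ler_nat alpha_ge_colour.
have upper : 5 * (alpha 5 d)%:R <= 'C(d + 4, 4)%:R + 4 :> rat.
  by rewrite -natrM -natrD ler_nat alpha_le_near.
by lra.
Qed.
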